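(* Let $X=(X^x)_{x\in\mathbb{R}}$ be a deterministic Hunt process on $\mathbb{R}$. Then $X$ is $C_b$-Feller if and only if either $X$ is of pure type, or every pair of neighbouring domains in its structure (written lower domain $|$ upper domain) is one of the building blocks $\oplus|\odot$, $\odot|\ominus$, or $\odot|\oplus$ with the left endpoint of $I_\oplus$ equal to $-\infty$, or $\ominus|\odot$ with the left endpoint of $I_\ominus$ equal to $-\infty$.
   Context: A deterministic Markov process on $\mathbb{R}$ is a family $(X^x)_{x\in\mathbb{R}}$ of functions $t\mapsto X_t^x\in\mathbb{R}$, $t\in[0,\infty)$, with $X_0^x=x$ and such that $X_s^x=X_t^y$ implies $X_{s+h}^x=X_{t+h}^y$ for every $h\ge 0$. It is a Hunt process if it is càdlàg and quasi-left continuous, which here means that all paths are continuous. Structure: a deterministic Hunt process is described by a decomposition of $\mathbb{R}$ into disjoint ordered intervals $(J_j)_{j\in Z}$, $Z=\{-n,\dots,m\}$ a set of consecutive integers with $n,m\in\mathbb{N}\cup\{\infty\}$ ($J_i$ lies below $J_j$ for $i<j$), such that on each $J_j$ either all paths $t\mapsto X^x_t$, $x\in J_j$, are constant (then $J_j$, possibly a single point, is a $\odot$-domain), or there is a continuous, surjective, strictly monotone generating path $\Phi_j:I_j\to J_j$, $I_j$ an interval containing $0$, with $X_t^x=\Phi_j(t+\Phi_j^{-1}(x))$ for $x\in J_j$ and $t\in[0,\infty)\cap(I_j-\Phi_j^{-1}(x))$; then $J_j$ is a $\oplus$-domain if $\Phi_j$ is increasing and a $\ominus$-domain if $\Phi_j$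 is decreasing, and one writes $\Phi_\oplus:I_\oplus\to J_\oplus$, $\Phi_\ominus:I_\ominus\to J_\ominus$. If the right endpoint of $I_j$ is finite, then paths from $J_j$ reach in finite time the adjacent endpoint of the neighbouring $\odot$-domain (above for $\oplus$, below for $\ominus$) and stay there forever. Neighbouring $\odot$-domains are merged into one. The sequence of types of the domains in increasing order is the structure of the process; the process is of pure type if there is only one domain. The semigroup is $T_tu(x)=u(X_t^x)$. Let $C_b(\mathbb{R})$ be the bounded continuous functions. $X$ is $C_b$-Feller if $T_t$ maps $C_b(\mathbb{R})$ into $C_b(\mathbb{R})$ for every $t\ge 0$ and $T_tu\to u$ locally uniformly as $t\downarrow0$ for every $u\in C_b(\mathbb{R})$. *)

(* Defs.v *)
From HB Require Import structures.
From mathcomp Require Import all_boot all_order all_algebra.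
From mathcomp Require Import all_classical all_reals all_analysis.

Set Implicit Arguments.
Unset Strict Implicit.
Unset Printing Implicit Defensive.

Import Order.TTheory GRing.Theory Num.Theory.
Import numFieldNormedType.Exports.

Local Open Scope classical_set_scope.
Local Open Scope ring_scope.

(* A family of paths is a function X : R -> R -> R, X x t standing for X_t^x.
   Time is [0, +oo[, so nothing depends on the values at t < 0. *)

Definition deterministic_markov (R : realType) (X : R -> R -> R) : Prop :=
  (forall x, X x 0 = x) /\
  (forall x y s t h : R, 0 <= s -> 0 <= t -> 0 <= h ->
     X x s = X y t -> X x (s + h) = X y (t + h)).

Definition deterministic_hunt (R : realType) (X : R -> R -> R) : Prop :=
  deterministic_markov X /\
  (forall x, {within `[0, +oo[, continuous (X x)}).

Definition semigroup (R : realType) (X : R -> R -> R) (t : R) (u : R -> R) :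
    R -> R :=
  fun x => u (X x t).

Definition Cb (R : realType) : set (R -> R) :=
  [set u : R -> R | continuous u /\ bounded_fun u].

Definition Cb_feller (R : realType) (X : R -> R -> R) : Prop :=
  (forall t : R, 0 <= t -> forall u, Cb u -> Cb (semigroup X t u)) /\
  (forall u, Cb u -> forall x : R, exists2 V : set R, nbhs x V &
     {uniform V, (fun t => semigroup X t u) @ 0^'+ --> u}).

Definition left_endpoint (R : realType) (A : set R) : \bar R :=
  ereal_inf [set x%:E | x in A].

Definition right_endpoint (R : realType) (A : set R) : \bar R :=
  ereal_sup [set x%:E | x in A].

(* The type of a domain; for the two moving types it comes with the interval Ij
   and the generating path Phi : Ij -> J, a total function used only on Ij. *)
Inductive domain_type (R : realType) : Type :=
| Odot
| Oplus (Ij : set R) (Phi : R -> R)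
| Ominus (Ij : set R) (Phi : R -> R).

Arguments Odot {R}.

Definition is_odot (R : realType) (d : domain_type R) : Prop :=
  if d is Odot then True else False.

(* s plays the role of Phi^-1(x). *)
Definition generating_path (R : realType) (X : R -> R -> R)
    (J Ij : set R) (Phi : R -> R) : Prop :=
  [/\ is_interval Ij, Ij 0, {within Ij, continuous Phi}, Phi @` Ij = J &
      forall x s t : R, Ij s -> Phi s = x -> 0 <= t -> Ij (t + s) ->
        X x t = Phi (t + s)].

Definition domain_spec (R : realType) (X : R -> R -> R) (J : set R)
    (d : domain_type R) : Prop :=
  match d with
  | Odot => forall x t : R, J x -> 0 <= t -> X x t = x
  | Oplus Ij Phi =>
      generating_path X J Ij Phi /\ {in Ij &, {homo Phi : s t / s < t}}
  | Ominus Ij Phi =>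
      generating_path X J Ij Phi /\ {in Ij &, {homo Phi : s t /~ s < t}}
  end.

Definition absorbed_at (R : realType) (X : R -> R -> R) (J : set R) (e : R) :
    Prop :=
  forall x, J x -> exists2 t0 : R, 0 <= t0 & forall t, t0 <= t -> X x t = e.

(* The index set {-n, ..., m}, where None stands for an infinite n or m. *)
Definition index_set (n m : option nat) : set int :=
  [set j : int | (if n is Some n' then - (n'%:Z) <= j else True) /\
                 (if m is Some m' then j <= m'%:Z else True)].

Record structure (R : realType) : Type := Structure {
  below : option nat;
  above : option nat;
  dom : int -> set R;
  type_of_dom : int -> domain_type R
}.

Definition indices (R : realType) (S : structure R) : set int :=
  index_set (below S) (above S).

(* A generating path of finite right endpoint runs into the adjacent endpoint e
   of a neighbouring odot-domain; e belongs to that domain, its path being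
   constant.  As e is not in dom S j, this excludes the degenerate Ij = {0}. *)
Definition exit_spec (R : realType) (X : R -> R -> R) (S : structure R)
    (j : int) : Prop :=
  match type_of_dom S j with
  | Odot => True
  | Oplus Ij _ => right_endpoint Ij \is a fin_num ->
      [/\ indices S (j + 1), is_odot (type_of_dom S (j + 1)) &
          exists e, [/\ left_endpoint (dom S (j + 1)) = e%:E,
                        dom S (j + 1) e & absorbed_at X (dom S j) e]]
  | Ominus Ij _ => right_endpoint Ij \is a fin_num ->
      [/\ indices S (j - 1), is_odot (type_of_dom S (j - 1)) &
          exists e, [/\ right_endpoint (dom S (j - 1)) = e%:E,
                        dom S (j - 1) e & absorbed_at X (dom S j) e]]
  end.

Record is_structure (R : realType) (X : R -> R -> R) (S : structure R) :
    Prop := IsStructure {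
  dom_interval : forall j, indices S j -> is_interval (dom S j);
  dom_nonempty : forall j, indices S j -> dom S j !=set0;
  dom_ordered : forall i j, indices S i -> indices S j -> i < j ->
    forall x y, dom S i x -> dom S j y -> x < y;
  dom_cover : forall x, exists2 j, indices S j & dom S j x;
  dom_type : forall j, indices S j ->
    domain_spec X (dom S j) (type_of_dom S j);
  dom_exit : forall j, indices S j -> exit_spec X S j;
  odot_merged : forall j, indices S j -> indices S (j + 1) ->
    ~ (is_odot (type_of_dom S j) /\ is_odot (type_of_dom S (j + 1)))
}.

Definition pure_type (R : realType) (S : structure R) : Prop :=
  exists j, indices S = [set j].

Definition building_block (R : realType) (lower upper : domain_type R) : Prop :=
  match lower, upper with
  | Oplus _ _, Odot => True
  | Odot, Ominus _ _ => True
  | Odot, Oplus Ij _ => left_endpoint Ij = -oo%E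
  | Ominus Ij _, Odot => left_endpoint Ij = -oo%E
  | _, _ => False
  end.

(* Main.v *)
(* Two paths of a deterministic Hunt process that cross must meet, and then they
   coalesce; hence every [X^~ t] is nondecreasing.  Therefore the local uniform
   convergence [T_t u --> u] is automatic, and the process is C_b-Feller iff
   every [X^~ t] is continuous, i.e. has no jump.  A jump of [X^~ t] to the right
   of [x] is impossible if some path through [x] visits a point above [x]; the
   remaining points [x] are constant points and maxima of ominus-domains, which
   the building blocks allow to be treated directly.  Conversely, a jump occurs
   at the lower end of every oplus-domain that is not the lowest domain, unless
   the left endpoint of its generating interval is -oo.  In the remaining
   forbidden pairs of moving domains the lower one has no maximum and the upper
   one no minimum, leaving no domain for the boundary point.  The statements about left limits and ominus-domains follow by the
   reflection [X x t |-> - X (- x) t]. *)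
Require Import Defs.
From mathcomp Require Import all_boot all_order all_algebra.
From mathcomp Require Import all_classical all_reals all_analysis.
From mathcomp Require Import lra zify.

Set Implicit Arguments.
Unset Strict Implicit.
Unset Printing Implicit Defensive.

Import Order.TTheory GRing.Theory Num.Theory.
Import numFieldNormedType.Exports.

Local Open Scope classical_set_scope.
Local Open Scope ring_scope.

(** * Deterministic Hunt flows *)

(** The two times may come in either order. The bound on [c] later makes [c - t] a nonnegative time
    and a return time positive. *)
Lemma path_IVT (R : realType) (X : R -> R -> R) (y a b v : R) :
  deterministic_hunt X -> 0 <= a -> 0 <= b -> X y a <= v <= X y b ->
  exists2 c, Num.min a b <= c & X y c = v.
Proof.
move=> [_ Xc] a0 b0 /andP[av vb].
have [ab|/ltW ba] := leP a b.
- have Xab : {within `[a, b], continuous (X y)}.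
    apply: continuous_subspaceW (Xc y) => t /=.
    by rewrite !in_itv /= andbT => /andP[/(le_trans a0)].
  have [|c] := IVT ab Xab (v := v).
    by rewrite ge_min av /= le_max vb orbT.
  by rewrite in_itv /= => /andP[ac _] Xc_v; exists c.
- have Xba : {within `[b, a], continuous (X y)}.
    apply: continuous_subspaceW (Xc y) => t /=.
    by rewrite !in_itv /= andbT => /andP[/(le_trans b0)].
  have [|c] := IVT ba Xba (v := v).
    by rewrite ge_min av orbT /= le_max vb.
  by rewrite in_itv /= => /andP[bc _] Xc_v; exists c.
Qed.

Lemma markov_shift (R : realType) (X : R -> R -> R) (x s t : R) :
  deterministic_hunt X -> 0 <= s -> 0 <= t -> X (X x s) t = X x (s + t).
Proof.
move=> [[X0 XM] _] s0 t0.
by rewrite -[in LHS](add0r t); apply: XM => //; rewrite X0.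
Qed.

Lemma hunt_nondecreasing (R : realType) (X : R -> R -> R) (t : R) :
  deterministic_hunt X -> 0 <= t -> {homo X^~ t : x y / x <= y}.
Proof.
move=> HX t0 x y; rewrite le_eqVlt => /predU1P[->//|xy].
have [[X0 XM] Xc] := HX.
rewrite leNgt; apply/negP => Xyx.
pose f s := X x s - X y s.
have fc : {within `[0, t], continuous f}.
  have sub : (`[0, t]%classic : set R) `<=` `[0, +oo[%classic.
    by move=> s /=; rewrite !in_itv /= andbT => /andP[].
  move=> s; apply: cvgB.
    exact: (continuous_subspaceW sub (Xc x)).
  exact: (continuous_subspaceW sub (Xc y)).
have [|s] := IVT t0 fc (v := 0).
  rewrite /f !X0 ge_min subr_le0 (ltW xy) /= le_max; apply/orP; right.
  by rewrite subr_ge0 ltW.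
rewrite in_itv /= => /andP[s0 st] /subr0_eq Xs.
have := XM x y s s (t - s) s0 s0; rewrite subr_ge0 => /(_ st Xs).
by rewrite addrC subrK => Xt; move: Xyx; rewrite Xt ltxx.
Qed.

Lemma path_cvg0 (R : realType) (X : R -> R -> R) (x : R) :
  deterministic_hunt X -> X x t @[t --> 0^'+] --> x.
Proof.
by move=> [[X0 _] Xc]; have /continuous_within_itvcyP[_] := Xc x; rewrite X0.
Qed.

(* Local uniform convergence is automatic: monotonicity in [x] turns the
   continuity of paths at time 0 into joint continuity at [(0, x)]. *)
Lemma hunt_uniform_cvg (R : realType) (X : R -> R -> R) (u : R -> R) (x : R) :
  deterministic_hunt X -> continuous u ->
  exists2 V : set R, nbhs x V &
    {uniform V, (fun t => semigroup X t u) @ 0^'+ --> u}.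
Proof.
move=> HX uc; exists `]x - 1, x + 1[%classic.
  by apply: near_in_itvoo; rewrite in_itv /=; lra.
move=> P /uniform_nbhs[E [[e /= e0 eE] EP]].
suff : \forall t \near 0^'+, `[x - 1, x + 1] `<=` [set y | E (u y, semigroup X t u y)].
  apply: filterS => t Kt; apply: EP => y /= yx; apply: Kt => /=.
  by move: yx; rewrite !in_itv /= => /andP[/ltW-> /ltW->].
(* Compactness in near-covering form: it suffices to treat [z] near a single [y] together with small
   [t]. *)
have /compact_near_coveringP := @segment_compact R (x - 1) (x + 1).
apply => y _.
have /cvgrPdist_lt/(_ (e / 2)) := uc y; rewrite divr_gt0// => /(_ isT).
move=> [d /= d0 du].
(* The paths from [y - d / 2] and [y + d / 2] enclose, by monotonicity, every path started between
   them; for small [t] both are still within [d] of [y]. *)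
have Xl := path_cvg0 (x := y - d / 2) HX.
have Xr := path_cvg0 (x := y + d / 2) HX.
have d2 : 0 < d / 2 by lra.
near=> z t.
have t0 : 0 < t by near: t; exact: nbhs_right_gt.
have yz : `|y - z| < d / 2 by near: z; exact: (nbhsx_ballx y (d / 2)).
have tl : `|y - d / 2 - X (y - d / 2) t| < d / 2.
  by near: t; move/cvgrPdist_lt : Xl; exact.
have tr : `|y + d / 2 - X (y + d / 2) t| < d / 2.
  by near: t; move/cvgrPdist_lt : Xr; exact.
have lz : X (y - d / 2) t <= X z t.
  by apply: (hunt_nondecreasing HX (ltW t0)); move: yz; rewrite ltr_norml; lra.
have zr : X z t <= X (y + d / 2) t.
  by apply: (hunt_nondecreasing HX (ltW t0)); move: yz; rewrite ltr_norml; lra.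
apply: eE => /=; rewrite /ball /= /semigroup.
have uz : `|u y - u z| < e / 2 by apply: du => /=; lra.
have uX : `|u y - u (X z t)| < e / 2.
  by apply: du => /=; move: tl tr; rewrite !ltr_norml; lra.
by move: uz uX; rewrite !ltr_norml; lra.
Unshelve. all: by end_near. Qed.

(* The test functions [y |-> (1 + `|y - X x t|)^-1] detect a discontinuity of
   [X^~ t] at [x]. *)
Lemma Cb_fellerP (R : realType) (X : R -> R -> R) :
  deterministic_hunt X ->
  Cb_feller X <-> forall t, 0 <= t -> continuous (X^~ t).
Proof.
move=> HX; split=> [[XCb _] t t0 x|Xc].
  pose u y := (1 + `|y - X x t|)^-1.
  have u0 y : 0 < 1 + `|y - X x t| by rewrite ltr_pwDl.
  have uCb : Cb u.
    split.
      move=> y; apply: cvgV; first by rewrite gt_eqF.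
      apply: cvgD; first exact: cvg_cst.
      by apply: cvg_norm; apply: cvgB; [exact: cvg_id|exact: cvg_cst].
    exists 1; split=> // M M1 y _ /=; apply: le_trans (ltW M1).
    by rewrite /u ger0_norm ?invr_ge0 ?(ltW (u0 _))// invf_le1// lerDl.
  have [+ _] := XCb t t0 u uCb => /(_ x)/cvgrPdist_lt uX.
  apply/cvgrPdist_lt => e e0.
  have e1 : 0 < 1 + e by lra.
  (* The drop of [u] from its peak value 1 to its value at distance [e] from [X x t]. *)
  have /uX : 0 < 1 - (1 + e)^-1 by rewrite subr_gt0 invf_lt1// ltrDl.
  apply: filterS => y; rewrite /semigroup /u subrr normr0 addr0 invr1 => Xy.
  have {Xy} : (1 + e)^-1 < (1 + `|X y t - X x t|)^-1.
    by move: Xy; rewrite ltr_norml; lra.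
  by rewrite ltf_pV2 ?posrE// ltrD2l distrC.
split=> [t t0 u [uc ub]|u [uc _] x]; last exact: hunt_uniform_cvg.
split=> [x|]; first by apply: continuous_comp; [exact: Xc|exact: uc].
by have [M [Mr Mu]] := ub; exists M; split=> // N /Mu uN x _; exact: uN.
Qed.

(** By monotonicity, one good point on each side of [x] controls all points between them. *)
Lemma hunt_continuous (R : realType) (X : R -> R -> R) (t x : R) :
  deterministic_hunt X -> 0 <= t ->
  (forall e, 0 < e -> exists2 y, x < y & X y t < X x t + e) ->
  (forall e, 0 < e -> exists2 y, y < x & X x t - e < X y t) ->
  {for x, continuous (X^~ t)}.
Proof.
move=> HX t0 Xr Xl; apply/cvgrPdist_lt => e e0.
have [y xy Xy] := Xr e e0; have [z zx Xz] := Xl e e0.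
near=> w.
have /andP[/ltW/(hunt_nondecreasing HX t0)/= zw
    /ltW/(hunt_nondecreasing HX t0)/= wy] : w \in `]z, y[.
  by near: w; apply: near_in_itvoo; rewrite in_itv /= zx.
by rewrite ltr_norml; lra.
Unshelve. all: by end_near. Qed.

(* A jump of [X^~ t] to the right of [x] would have to be crossed by the path
   [h |-> X (X y h) t], which is continuous in [h]. *)
Lemma right_continuous_path (R : realType) (X : R -> R -> R) (t x y h k e : R) :
  deterministic_hunt X -> 0 <= t -> 0 <= h -> 0 <= k ->
  X y h = x -> x < X y k -> 0 < e ->
  exists2 z, x < z & X z t < X x t + e.
Proof.
move=> HX t0 h0 k0 yhx xyk e0.
have [Xkt|Xkt] := ltP (X (X y k) t) (X x t + e); first by exists (X y k).
have [|||c] := @path_IVT R X y (h + t) (k + t) (X x t + e / 2) HX.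
- exact: addr_ge0.
- exact: addr_ge0.
- by rewrite -!markov_shift// yhx; lra.
have -> : Num.min (h + t) (k + t) = Num.min h k + t by rewrite addr_minl.
move=> hkc; have ct0 : 0 <= c - t.
  rewrite subr_ge0; apply: le_trans hkc.
  by rewrite lerDr le_min h0 k0.
rewrite -(subrK t c) -markov_shift// => Xc.
exists (X y (c - t)); last by lra.
(* A point at or below [x] would by monotonicity be at most [X x t] after time [t], not
   [X x t + e / 2]. *)
rewrite ltNge; apply/negP => /(hunt_nondecreasing HX t0)/=; lra.
Qed.

Lemma periodic_path (R : realType) (X : R -> R -> R) (x t : R) (n : nat) :
  deterministic_hunt X -> 0 <= t -> X x t = x -> X x (t *+ n) = x.
Proof.
move=> HX t0 xt; have [[X0 _] _] := HX.
elim: n => [|n IH]; first by rewrite mulr0n X0.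
by rewrite mulrS -markov_shift ?mulrn_wge0// xt.
Qed.

(** * Domains of the structure *)

Lemma index_set_convex (n m : option nat) (i j k : int) :
  index_set n m i -> index_set n m k -> i <= j -> j <= k -> index_set n m j.
Proof.
by case: n m => [n|] [m|] [/= i1 _] [/= _ k2] ij jk; split => //=; lia.
Qed.

Lemma upward_closed (R : realType) (I : set R) (s r : R) :
  is_interval I -> right_endpoint I \isn't a fin_num -> I s -> s <= r -> I r.
Proof.
move=> itv I_inf Is sr.
have [b Ib rb] : exists2 b, I b & r <= b.
  apply: contrapT => I_ub.
  have I_bounded : has_ubound I.
    exists r => b Ib; rewrite leNgt; apply/negP => rb.
    by apply: I_ub; exists b => //; exact: ltW.
  by move/negP: I_inf; rewrite /right_endpoint ereal_sup_EFin //; exists s.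
by apply: (itv s b) => //; rewrite sr.
Qed.

Lemma downward_closed (R : realType) (I : set R) (s r : R) :
  is_interval I -> left_endpoint I = -oo%E -> I s -> r <= s -> I r.
Proof.
move=> itv I_inf Is rs.
have [_ [a Ia <-]] := lb_ereal_infNy_adherent r I_inf.
by rewrite lte_fin => /ltW ar; apply: (itv a s) => //; rewrite ar.
Qed.

(* [lra] fails on hypotheses that are equations in a type without eqType. *)
Ltac reals :=
  repeat match goal with
  | H : @eq (set _) _ _ |- _ => clear H
  | H : @eq (domain_type _) _ _ |- _ => clear H
  end; lra.

Section Structure.
Variables (R : realType) (X : R -> R -> R) (S : structure R).
Hypotheses (HX : deterministic_hunt X) (HS : is_structure X S).
Implicit Types (I : set R) (Phi : R -> R) (j : int) (x y : R).

Lemma dom_between j x y z : indices S j -> indices S (j + 1) ->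
  dom S j x -> dom S (j + 1) y -> x <= z -> z <= y ->
  dom S j z \/ dom S (j + 1) z.
Proof.
move=> Sj Sj1 Jx Jy xz zy; have [i Si Jz] := dom_cover HS z.
have [ij|ji|<-] := ltgtP i j; last by left.
  by have := dom_ordered HS Si Sj ij Jz Jx; lra.
have [ji1|ij1|<-] := ltgtP i (j + 1); last by right.
  lia.
by have := dom_ordered HS Sj1 Si ij1 Jy Jz; lra.
Qed.

(** The supremum of the lower domain would lie in neither domain, although the two together leave no
    gap. *)
Lemma no_open_cut j : indices S j -> indices S (j + 1) ->
  (forall x, dom S j x -> exists2 x', dom S j x' & x < x') ->
  (forall y, dom S (j + 1) y -> exists2 y', dom S (j + 1) y' & y' < y) ->
  False.
Proof.
move=> Sj Sj1 nomax nomin.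
have [x0 Jx0] := dom_nonempty HS Sj; have [y0 Jy0] := dom_nonempty HS Sj1.
have ordered x y : dom S j x -> dom S (j + 1) y -> x < y.
  by apply: (dom_ordered HS) => //; lia.
have ub y : dom S (j + 1) y -> ubound (dom S j) y.
  by move=> Jy x Jx; exact/ltW/ordered.
have J_sup : has_sup (dom S j) by split; [exists x0|exists y0; exact: ub].
have p_le y : dom S (j + 1) y -> sup (dom S j) <= y.
  by move=> /ub; apply: ge_sup; exists x0.
have [] := dom_between (z := sup (dom S j)) Sj Sj1 Jx0 Jy0.
- exact: ub_le_sup J_sup.2 _ Jx0.
- exact: p_le.
- move=> /nomax[x' Jx']; apply/negP; rewrite -leNgt.
  exact: ub_le_sup J_sup.2 _ Jx'.
- by move=> /nomin[y' /p_le Jy']; apply/negP; rewrite -leNgt.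
Qed.

Lemma oplus_exit j I Phi : indices S j -> type_of_dom S j = Oplus I Phi ->
  (forall s r, I s -> s <= r -> I r) \/
  [/\ indices S (j + 1), is_odot (type_of_dom S (j + 1)) &
      exists2 e, dom S (j + 1) e & forall y, dom S (j + 1) y -> e <= y].
Proof.
move=> Sj Tj; have := dom_exit HS Sj; have := dom_type HS Sj.
rewrite /exit_spec Tj => -[[itv _ _ _ _] _] exit.
have [/exit[Sj1 Tj1 [e [le_e Je _]]]|I_inf] :=
  boolP (right_endpoint I \is a fin_num); last first.
  by left=> s r; exact: upward_closed.
right; split=> //; exists e => // y Jy.
by rewrite -lee_fin -le_e; apply: ereal_inf_lbound; exists y.
Qed.

(** Unlike in [oplus_exit], absorption at [e] is retained: it is what contradicts periodicity in
    [ominus_le]. *)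
Lemma ominus_exit j I Phi : indices S j -> type_of_dom S j = Ominus I Phi ->
  (forall s r, I s -> s <= r -> I r) \/
  indices S (j - 1) /\
    exists2 e, dom S (j - 1) e & absorbed_at X (dom S j) e.
Proof.
move=> Sj Tj; have := dom_exit HS Sj; have := dom_type HS Sj.
rewrite /exit_spec Tj => -[[itv _ _ _ _] _] exit.
have [/exit[Sj1 _ [e [_ Je abs_e]]]|I_inf] :=
  boolP (right_endpoint I \is a fin_num); last first.
  by left=> s r; exact: upward_closed.
by right; split=> //; exists e.
Qed.

(** * Motion along the generating paths *)

Lemma oplus_mono j I Phi s r : indices S j -> type_of_dom S j = Oplus I Phi ->
  I s -> I r -> (Phi s < Phi r) = (s < r).
Proof.
move=> Sj Tj Is Ir; have := dom_type HS Sj; rewrite Tj => -[_ mono].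
by apply: (leW_mono_in (le_mono_in mono)); rewrite inE.
Qed.

Lemma ominus_mono j I Phi s r : indices S j -> type_of_dom S j = Ominus I Phi ->
  I s -> I r -> (Phi s < Phi r) = (r < s).
Proof.
move=> Sj Tj Is Ir; have := dom_type HS Sj; rewrite Tj => -[_ mono].
by apply: (leW_nmono_in (le_nmono_in mono)); rewrite inE.
Qed.

Lemma oplus_path j I Phi : indices S j -> type_of_dom S j = Oplus I Phi ->
  generating_path X (dom S j) I Phi.
Proof. by move=> Sj Tj; have := dom_type HS Sj; rewrite Tj => -[]. Qed.

Lemma ominus_path j I Phi : indices S j -> type_of_dom S j = Ominus I Phi ->
  generating_path X (dom S j) I Phi.
Proof. by move=> Sj Tj; have := dom_type HS Sj; rewrite Tj => -[]. Qed.

Lemma odot_path j x t : indices S j -> type_of_dom S j = Odot ->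
  dom S j x -> 0 <= t -> X x t = x.
Proof. by move=> Sj Tj; have := dom_type HS Sj; rewrite Tj; exact. Qed.

(* The generating interval has no greatest element: otherwise the path would
   stop short of the point [e] at which it must be absorbed. *)
Lemma oplus_forward j I Phi s : indices S j -> type_of_dom S j = Oplus I Phi ->
  I s -> exists2 h, 0 < h & I (h + s).
Proof.
move=> Sj Tj Is; have [itv _ _ PhiI _] := oplus_path Sj Tj.
have [up|[Sj1 _ [e Je e_min]]] := oplus_exit Sj Tj.
  by exists 1 => //; apply: up Is _; rewrite lerDr.
have Js : dom S j (Phi s) by rewrite -PhiI; exists s.
have se : Phi s < e by apply: (dom_ordered HS Sj Sj1) => //; lia.
(* The midpoint lies below the minimum [e] of the upper domain, hence in the lower one, at a
   parameter beyond [s]. *)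
have [||Jz|/e_min] := dom_between (z := (Phi s + e) / 2) Sj Sj1 Js Je; try reals.
move: Jz; rewrite -PhiI => -[r Ir rz].
have sr : s < r by rewrite -(oplus_mono Sj Tj)// rz; reals.
by exists (r - s); [rewrite subr_gt0|rewrite subrK].
Qed.

Lemma oplus_rises j I Phi x : indices S j -> type_of_dom S j = Oplus I Phi ->
  dom S j x -> exists h, [/\ 0 <= h, x < X x h & dom S j (X x h)].
Proof.
move=> Sj Tj; have [_ _ _ PhiI path] := oplus_path Sj Tj.
rewrite -PhiI => -[s Is <-]; have [h h0 Ihs] := oplus_forward Sj Tj Is.
have {}path : X (Phi s) h = Phi (h + s) by apply: path => //; exact: ltW.
exists h; rewrite path; split; [exact: ltW| |by exists (h + s)].
by rewrite (oplus_mono Sj Tj)// ltrDr.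
Qed.

Lemma oplus_no_min j I Phi x : indices S j -> type_of_dom S j = Oplus I Phi ->
  left_endpoint I = -oo%E -> dom S j x -> exists2 y, dom S j y & y < x.
Proof.
move=> Sj Tj I_inf; have [itv _ _ PhiI path] := oplus_path Sj Tj.
rewrite -PhiI => -[s Is <-].
have Is1 : I (s - 1) by apply: downward_closed I_inf Is _ => //; rewrite gerBl.
exists (Phi (s - 1)); first by exists (s - 1).
by rewrite (oplus_mono Sj Tj)// gtrBl.
Qed.

Lemma ominus_no_max j I Phi x : indices S j -> type_of_dom S j = Ominus I Phi ->
  left_endpoint I = -oo%E -> dom S j x -> exists2 y, dom S j y & x < y.
Proof.
move=> Sj Tj I_inf; have [itv _ _ PhiI path] := ominus_path Sj Tj.
rewrite -PhiI => -[s Is <-].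
have Is1 : I (s - 1) by apply: downward_closed I_inf Is _ => //; rewrite gerBl.
exists (Phi (s - 1)); first by exists (s - 1).
by rewrite (ominus_mono Sj Tj)// gtrBl.
Qed.

(* A path that rose above its starting point would have to come back through
   it, hence be periodic and never be absorbed. *)
Lemma ominus_le j I Phi x t : indices S j -> type_of_dom S j = Ominus I Phi ->
  dom S j x -> 0 <= t -> X x t <= x.
Proof.
move=> Sj Tj Jx t0; have [_ _ _ PhiI path] := ominus_path Sj Tj.
have [up|[Sj1 [e Je abs_e]]] := ominus_exit Sj Tj.
  move: Jx; rewrite -PhiI => -[s Is <-].
  have Its : I (t + s) by apply: up Is _; rewrite lerDr.
  by rewrite (path _ s) // leNgt (ominus_mono Sj Tj)// -leNgt lerDr.
have ex : e < x by apply: (dom_ordered HS Sj1 Sj) => //; lia.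
rewrite leNgt; apply/negP => xX.
have [T T0 XT] := abs_e _ Jx.
(* Above [x] at time [t] and at [e < x] at time [t + T], the path is back at [x] at some time
   [c >= t]. *)
have [|||c] := @path_IVT R X x (t + T) t x HX => //; first exact: addr_ge0.
  by rewrite XT ?lerDr// !ltW.
rewrite (min_idPr _) ?lerDl// => tc xc.
have t_gt0 : 0 < t.
  rewrite lt_neqAle t0 andbT; apply/eqP => t_eq0.
  by move: xX; rewrite -t_eq0; have [[-> _] _] := HX; rewrite ltxx.
have c0 : 0 < c by exact: lt_le_trans tc.
(* This many periods of length [c] outlast the absorption time [T], so the path is at both [x] and
   [e]. *)
have := periodic_path (Num.bound (T / c)) HX (ltW c0) xc.
rewrite XT => [e_x|]; first by move: ex; rewrite e_x ltxx.
rewrite -mulr_natr mulrC -ler_pdivrMr//; exact/ltW/archi_boundP/divr_ge0/ltW.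
Qed.

(** * Behaviour at the boundary between neighbouring domains *)

Lemma path_below_oplus j I Phi x y t : indices S j -> indices S (j + 1) ->
  type_of_dom S (j + 1) = Oplus I Phi -> 0 <= t ->
  dom S j x -> dom S (j + 1) y -> X x t < y.
Proof.
move=> Sj Sj1 Tj1 t0 Jx Jy.
have ordered z : dom S j z -> z < y.
  by move=> Jz; apply: (dom_ordered HS Sj Sj1) => //; lia.
(* Constant paths stay and decreasing ones do not rise; increasing ones could leave only into a
   constant domain above, whereas that neighbour is moving. *)
case Tj : (type_of_dom S j) => [|I' Phi'|I' Phi'].
- by rewrite (odot_path Sj Tj Jx t0); exact: ordered.
- have [up|[_]] := oplus_exit Sj Tj; last by rewrite Tj1.
  have [_ _ _ PhiI path] := oplus_path Sj Tj.
  apply: ordered; move: Jx; rewrite -PhiI => -[s Is <-].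
  have Its : I' (t + s) by apply: up Is _; rewrite lerDr.
  by rewrite (path _ s) //; exists (t + s).
- exact: le_lt_trans (ominus_le Sj Tj Jx t0) (ordered _ Jx).
Qed.

(* Otherwise the domain would be left uniformly fast near its lower end, so
   that [X^~ t] would jump there. *)
Lemma oplus_left_endpoint j I Phi : indices S j -> indices S (j + 1) ->
  type_of_dom S (j + 1) = Oplus I Phi ->
  (forall t, 0 <= t -> continuous (X^~ t)) -> left_endpoint I = -oo%E.
Proof.
move=> Sj Sj1 Tj1 Xc; apply: contrapT => I_fin.
have [itv I0 _ PhiI path] := oplus_path Sj1 Tj1.
have I_inf : has_inf I.
  split; first by exists 0.
  have lb s : I s -> (left_endpoint I <= s%:E)%E.
    by move=> Is; apply: ereal_inf_lbound; exists s.
  move: I_fin lb; case: (left_endpoint I) => [l _ lb|_ /(_ _ I0)|//] //.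
  by exists l => s /lb; rewrite lee_fin.
set a := inf I in I_inf.
have a_le s : I s -> a <= s by move=> Is; exact: ge_inf I_inf.2 _ Is.
(* [r > 0] will put images above [Phi 0]; [q] gives room for [t + s'] to remain in [I] when
   [s' < a + q]. *)
have [r r0 Ir] := oplus_forward Sj1 Tj1 I0; rewrite addr0 in Ir.
have [q q0 Iqr] := oplus_forward Sj1 Tj1 Ir.
(* The time carrying the lower end [a] of [I] to [r]: every parameter of [I] is moved to [r] or
   beyond. *)
pose t := r - a; have t0 : 0 <= t by rewrite subr_ge0 a_le.
have [s Is sa] := inf_adherent q0 I_inf; rewrite -/a in sa.
have [x Jx] := dom_nonempty HS Sj.
have J0 : dom S (j + 1) (Phi 0) by rewrite -PhiI; exists 0.
have Js : dom S (j + 1) (Phi s) by rewrite -PhiI; exists s.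
have xs : x < Phi s by apply: (dom_ordered HS Sj Sj1) => //; lia.
have It s' : I s' -> s' <= s -> I (t + s').
  move=> Is' s's; have as' := a_le _ Is'.
  by apply: (itv r (q + r)) => //; rewrite /t; reals.
have Xt s' : I s' -> s' <= s -> Phi 0 < X (Phi s') t.
  move=> Is' s's; have It' := It _ Is' s's.
  rewrite (path _ s')// (oplus_mono Sj1 Tj1)// /t.
  by have := a_le _ Is'; reals.
(* The intermediate value theorem in space: continuity would force the value [Phi 0], but points of
   the lower domain land below it and points of the upper one up to [Phi s] land above it. *)
have [||c] := @IVT R (X^~ t) x (Phi s) (Phi 0) (ltW xs).
- exact: continuous_subspaceT (Xc _ t0).
- have := path_below_oplus Sj Sj1 Tj1 t0 Jx J0.
  by rewrite ge_min le_max => /ltW->; rewrite (ltW (Xt _ _ _)) ?orbT.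
rewrite in_itv /= => /andP[xc cs] Xct.
have [Jc|Jc] := dom_between Sj Sj1 Jx Js xc cs.
  by have := path_below_oplus Sj Sj1 Tj1 t0 Jc J0; rewrite Xct ltxx.
move: Jc cs Xct; rewrite -PhiI => -[s' Is' <-].
rewrite leNgt (oplus_mono Sj1 Tj1)// -leNgt => s's Xct.
by have := Xt _ Is' s's; rewrite Xct ltxx.
Qed.

Lemma right_continuity j x t e : (forall i, indices S i -> indices S (i + 1) ->
    building_block (type_of_dom S i) (type_of_dom S (i + 1))) ->
  indices S j -> dom S j x -> 0 <= t -> 0 < e ->
  exists2 y, x < y & X y t < X x t + e.
Proof.
move=> blocks Sj Jx t0 e0; have [[X0 _] _] := HX.
have [[x' Jx' xx']|x_max] := pselect (exists2 x', dom S j x' & x < x').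
  case Tj : (type_of_dom S j) => [|I Phi|I Phi].
  - have [y [xy yx' ye]] : exists y, [/\ x < y, y <= x' & y < x + e].
      exists (Num.min x' (x + e / 2)).
      by rewrite lt_min xx' ge_min lexx gt_min; split=> //; reals.
    exists y => //; rewrite !(odot_path Sj Tj)//.
    by apply: (dom_interval HS Sj Jx Jx'); rewrite (ltW xy).
  - have [h [h0 xXh _]] := oplus_rises Sj Tj Jx.
    by apply: (right_continuous_path HX t0 (lexx 0) h0 (X0 x) xXh).
  - have [_ _ _ PhiI path] := ominus_path Sj Tj.
    move: Jx Jx' xx'; rewrite -PhiI => -[s Is <-] [s' Is' <-].
    rewrite (ominus_mono Sj Tj)// => s's.
    (* The path from [Phi s'] starts above [x] and passes through [x] at time [s - s']. *)
    apply: (@right_continuous_path _ _ t _ (Phi s') (s - s') 0) => //.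
    + by rewrite subr_ge0 ltW.
    + by rewrite (path _ s') ?subrK// subr_ge0 ltW.
    + by rewrite X0 (ominus_mono Sj Tj).
(* Here [x] is the maximum of its domain, so [x + 1] lies in a higher one and an upper neighbour
   exists. *)
have [i Si Ji] := dom_cover HS (x + 1).
have ji : j < i.
  have [ij|//|ij] := ltgtP i j; last first.
    by case: x_max; exists (x + 1); [rewrite -ij|rewrite ltrDl].
  by have := dom_ordered HS Si Sj ij Ji Jx; reals.
have Sj1 : indices S (j + 1) by apply: index_set_convex Sj Si _ _; lia.
have block := blocks _ Sj Sj1.
case Tj : (type_of_dom S j) block => [|I Phi|I Phi].
- move=> block.
  have approach z0 : 0 < z0 -> exists z, [/\ dom S (j + 1) z, x < z & z < x + z0].
    move=> z00; have [w Jw] := dom_nonempty HS Sj1.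
    have xw : x < w by apply: (dom_ordered HS Sj Sj1) => //; lia.
    have xz : x < Num.min w (x + z0 / 2) by rewrite lt_min xw; reals.
    exists (Num.min w (x + z0 / 2)); split => //; last by rewrite gt_min; reals.
    have [|Jz|//] := dom_between Sj Sj1 Jx Jw (ltW xz).
      by rewrite ge_min lexx.
    by case: x_max; exists (Num.min w (x + z0 / 2)).
  rewrite (odot_path Sj Tj Jx)//; have [z [Jz xz ze]] := approach _ e0.
  case Tj1 : (type_of_dom S (j + 1)) block => [//|I Phi|I Phi] /= block.
  + have [itv _ _ PhiI path] := oplus_path Sj1 Tj1.
    have Jx1 y : dom S (j + 1) y -> x < y.
      by move=> Jy; apply: (dom_ordered HS Sj Sj1) => //; lia.
    move: Jz ze; rewrite -PhiI => -[r Ir <-] ze.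
    (* An infinite past allows starting a time [t] before [Phi r], which is within [e] of [x]. *)
    have Irt : I (r - t) by apply: downward_closed block Ir _ => //; rewrite gerBl.
    exists (Phi (r - t)); first by apply: Jx1; rewrite -PhiI; exists (r - t).
    by rewrite (path _ (r - t)) ?subrKC // addrC subrK.
  + exists z => //; apply: le_lt_trans ze; exact: ominus_le Sj1 Tj1 Jz t0.
- by have [h [_ xXh JX]] := oplus_rises Sj Tj Jx; case: x_max; exists (X x h).
- case: (type_of_dom S (j + 1)) => //= I_inf.
  by case: x_max; have [y] := ominus_no_max Sj Tj I_inf Jx; exists y.
Qed.
End Structure.

(** * Reflection *)

Definition reflect_paths (R : realType) (X : R -> R -> R) : R -> R -> R :=
  fun x t => - X (- x) t.

(** Space is reflected but time is not, so the generating interval is kept. *)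
Definition reflect_type (R : realType) (d : domain_type R) : domain_type R :=
  match d with
  | Odot => Odot
  | Oplus Ij Phi => Ominus Ij (fun s => - Phi s)
  | Ominus Ij Phi => Oplus Ij (fun s => - Phi s)
  end.

Definition reflect_structure (R : realType) (S : structure R) : structure R :=
  Structure (above S) (below S) (fun j => [set x | dom S (- j) (- x)])
            (fun j => reflect_type (type_of_dom S (- j))).

Lemma reflect_hunt (R : realType) (X : R -> R -> R) :
  deterministic_hunt X -> deterministic_hunt (reflect_paths X).
Proof.
move=> [[X0 XM] Xc]; split; [split|].
- by move=> x; rewrite /reflect_paths X0 opprK.
- move=> x y s t h s0 t0 h0 /oppr_inj Xst.
  by congr (- _); exact: XM.
- by move=> x t; apply: cvgN; exact: Xc.
Qed.

Lemma indices_reflect (R : realType) (S : structure R) (j : int) :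
  indices (reflect_structure S) j <-> indices S (- j).
Proof.
rewrite /indices /index_set /=.
by case: (above S) (below S) => [m|] [n|]; split=> -[]; split=> //; lia.
Qed.

Lemma image_EFin_opp (R : realType) (A : set R) :
  [set x%:E | x in [set x | A (- x)]] = -%E @` [set x%:E | x in A].
Proof.
apply/seteqP; split=> [_ [x /= Ax <-]|_ [_ [x Ax <-] <-]] /=.
  by exists (- x)%:E; [exists (- x)|rewrite -EFinN opprK].
by exists (- x); rewrite /= ?opprK.
Qed.

Lemma left_endpoint_reflect (R : realType) (A : set R) :
  left_endpoint [set x | A (- x)] = (- right_endpoint A)%E.
Proof. by rewrite /left_endpoint image_EFin_opp ereal_infN. Qed.

Lemma right_endpoint_reflect (R : realType) (A : set R) :
  right_endpoint [set x | A (- x)] = (- left_endpoint A)%E.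
Proof. by rewrite /right_endpoint image_EFin_opp ereal_supN. Qed.

Lemma generating_path_reflect (R : realType) (X : R -> R -> R) (J I : set R)
    (Phi : R -> R) : generating_path X J I Phi ->
  generating_path (reflect_paths X) [set x | J (- x)] I (fun s => - Phi s).
Proof.
move=> [itv I0 Phic PhiI path]; split=> //.
- by move=> s; apply: cvgN; exact: Phic.
- apply/seteqP; split=> [_ [s Is <-]|x /=]; rewrite /= -PhiI.
    by exists s => //; rewrite opprK.
  by move=> [s Is sx]; exists s => //; rewrite sx opprK.
- move=> x s t Is <- t0 Its; rewrite /reflect_paths opprK.
  by rewrite (path _ s).
Qed.

Lemma absorbed_reflect (R : realType) (X : R -> R -> R) (J : set R) (e : R) :
  absorbed_at X J e ->
  absorbed_at (reflect_paths X) [set x | J (- x)] (- e).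
Proof.
move=> abs x /= /abs[T T0 XT]; exists T => // t Tt.
by rewrite /reflect_paths XT.
Qed.

Lemma is_odot_reflect (R : realType) (d : domain_type R) :
  is_odot (reflect_type d) <-> is_odot d.
Proof. by case: d. Qed.

Lemma reflect_is_structure (R : realType) (X : R -> R -> R) (S : structure R) :
  is_structure X S -> is_structure (reflect_paths X) (reflect_structure S).
Proof.
move=> [itv ne ord cov type exit merged].
split.
- move=> j /indices_reflect/itv J_itv x y /= Jx Jy z /andP[xz zy].
  by apply: (J_itv _ _ Jy Jx); rewrite !lerN2 xz zy.
- move=> j /indices_reflect/ne[x Jx]; exists (- x).
  by rewrite /= opprK.
- move=> i j /indices_reflect Si /indices_reflect Sj ij x y /= Jx Jy.
  by rewrite -ltrN2; apply: ord Jy Jx; rewrite // ltrN2.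
- move=> x; have [j Sj Jx] := cov (- x); exists (- j).
    by apply/indices_reflect; rewrite opprK.
  by rewrite /= opprK.
- move=> j /indices_reflect/type /=.
  rewrite /domain_spec; case: (type_of_dom S (- j)) => [|I Phi|I Phi] /=.
  + by move=> XJ x t Jx t0; rewrite /reflect_paths XJ// opprK.
  + move=> [/generating_path_reflect path mono]; split=> //.
    by move=> s r Is Ir sr; rewrite ltrN2; exact: mono.
  + move=> [/generating_path_reflect path mono]; split=> //.
    by move=> s r Is Ir sr; rewrite ltrN2; exact: mono.
- move=> j /indices_reflect/exit; rewrite /exit_spec /=.
  case: (type_of_dom S (- j)) => [//|I Phi|I Phi] /= I_exit /I_exit.
  + have -> : - j + 1 = - (j - 1) by lia.
    move=> [Sj1 Tj1 [e [e_end Je abs_e]]].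
    split; [exact/indices_reflect|exact/is_odot_reflect|].
    exists (- e); split; last exact: absorbed_reflect.
      by rewrite right_endpoint_reflect e_end.
    by rewrite /= opprK.
  + have -> : - j - 1 = - (j + 1) by lia.
    move=> [Sj1 Tj1 [e [e_end Je abs_e]]].
    split; [exact/indices_reflect|exact/is_odot_reflect|].
    exists (- e); split; last exact: absorbed_reflect.
      by rewrite left_endpoint_reflect e_end.
    by rewrite /= opprK.
- move=> j /indices_reflect Sj /indices_reflect Sj1 /= [/is_odot_reflect Tj].
  move=> /is_odot_reflect Tj1; apply: (merged _ Sj1).
    by rewrite opprD subrK.
  by rewrite opprD subrK -opprD.
Qed.

(** Reflection exchanges [Oplus | Odot] with [Odot | Ominus], and [Odot | Oplus] with
    [Ominus | Odot]; the condition on the left endpoint is preserved. *)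
Lemma building_blocks_reflect (R : realType) (S : structure R) :
  (forall j, indices S j -> indices S (j + 1) ->
     building_block (type_of_dom S j) (type_of_dom S (j + 1))) ->
  forall j, indices (reflect_structure S) j ->
    indices (reflect_structure S) (j + 1) ->
    building_block (type_of_dom (reflect_structure S) j)
      (type_of_dom (reflect_structure S) (j + 1)).
Proof.
move=> blocks j /indices_reflect Sj /indices_reflect Sj1 /=.
have := blocks _ Sj1; rewrite opprD subrK => /(_ Sj).
by case: (type_of_dom S (- j)) (type_of_dom S _) => [|? ?|? ?] [|? ?|? ?].
Qed.

(** * Left limits and decreasing domains by reflection *)

Lemma blocks_continuous (R : realType) (X : R -> R -> R) (S : structure R) t :
  deterministic_hunt X -> is_structure X S ->
  (forall j, indices S j -> indices S (j + 1) ->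
     building_block (type_of_dom S j) (type_of_dom S (j + 1))) ->
  0 <= t -> continuous (X^~ t).
Proof.
move=> HX HS blocks t0 x; apply: hunt_continuous => // e e0.
  have [j Sj Jx] := dom_cover HS x.
  exact: (right_continuity HX HS blocks Sj Jx).
(* Approach from the left at [x] is approach from the right at [- x] for the reflected process. *)
have [j Sj Jx] := dom_cover (reflect_is_structure HS) (- x).
have [y xy Xy] := right_continuity (reflect_hunt HX) (reflect_is_structure HS)
  (building_blocks_reflect blocks) Sj Jx t0 e0.
exists (- y); first by rewrite ltrNl.
by move: Xy; rewrite /reflect_paths opprK; lra.
Qed.

(** The pair [j], [j + 1] reflects to [- (j + 1)], [- j], whose upper member is increasing, so
    [oplus_left_endpoint] applies. *)
Lemma ominus_left_endpoint (R : realType) (X : R -> R -> R) (S : structure R)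
    (j : int) (I : set R) (Phi : R -> R) :
  deterministic_hunt X -> is_structure X S ->
  indices S j -> indices S (j + 1) -> type_of_dom S j = Ominus I Phi ->
  (forall t, 0 <= t -> continuous (X^~ t)) -> left_endpoint I = -oo%E.
Proof.
move=> HX HS Sj Sj1 Tj Xc.
have jE : - (- (j + 1) + 1) = j by rewrite opprD opprK addrK.
apply: (@oplus_left_endpoint _ (reflect_paths X) (reflect_structure S)
  (reflect_hunt HX) (reflect_is_structure HS) (- (j + 1)) I (fun s => - Phi s)).
- by apply/indices_reflect; rewrite opprK.
- by apply/indices_reflect; rewrite jE.
- by rewrite /= jE Tj.
- move=> t t0 x; apply: cvgN.
  by apply: (@continuous_comp _ _ _ -%R (X^~ t)); [exact: opp_continuous|exact: Xc].
Qed.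

Lemma ominus_no_min (R : realType) (X : R -> R -> R) (S : structure R)
    (j : int) (I : set R) (Phi : R -> R) (x : R) :
  is_structure X S -> indices S j -> type_of_dom S j = Ominus I Phi ->
  dom S j x -> exists2 y, dom S j y & y < x.
Proof.
move=> HS Sj Tj Jx.
have [||/=|h [_ ]] := @oplus_rises _ (reflect_paths X) (reflect_structure S)
  (reflect_is_structure HS) (- j) I (fun s => - Phi s) (- x).
- by apply/indices_reflect; rewrite opprK.
- by rewrite /= opprK Tj.
- by rewrite !opprK.
rewrite /reflect_paths /= !opprK ltrN2 => Xx JX.
by exists (X x h).
Qed.

Theorem theorem3p6 (R : realType) (X : R -> R -> R) (S : structure R) :
  deterministic_hunt X -> is_structure X S ->
  (Cb_feller X <->
   (pure_type S \/
    forall j : int, indices S j -> indices S (j + 1) ->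
      building_block (type_of_dom S j) (type_of_dom S (j + 1)))).
Proof.
move=> HX HS; rewrite Cb_fellerP//; split=> [Xc|blocks t t0]; last first.
  (* With a single index there is no neighbouring pair, so pure type satisfies the block condition
     vacuously. *)
  apply: (blocks_continuous HX HS) => //; case: blocks => // -[i Si] j.
  by rewrite Si /= => -> /eqP; lia.
right=> j Sj Sj1; have merged := odot_merged HS Sj Sj1.
have cut := no_open_cut HS Sj Sj1.
have plus_max I Phi : type_of_dom S j = Oplus I Phi ->
    forall x, dom S j x -> exists2 x', dom S j x' & x < x'.
  by move=> Tj x Jx; have [h [_ xXh JX]] := oplus_rises HS Sj Tj Jx; exists (X x h).
have minus_min I Phi (Tj1 : type_of_dom S (j + 1) = Ominus I Phi) y :=
  ominus_no_min HS Sj1 Tj1 (x := y).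
have plus_inf I Phi (Tj1 : type_of_dom S (j + 1) = Oplus I Phi) :=
  oplus_left_endpoint HX HS Sj Sj1 Tj1 Xc.
have minus_inf I Phi (Tj : type_of_dom S j = Ominus I Phi) :=
  ominus_left_endpoint HX HS Sj Sj1 Tj Xc.
have plus_min I Phi (Tj1 : type_of_dom S (j + 1) = Oplus I Phi) y :=
  oplus_no_min HS Sj1 Tj1 (plus_inf _ _ Tj1) (x := y).
have minus_max I Phi (Tj : type_of_dom S j = Ominus I Phi) x :=
  ominus_no_max HS Sj Tj (minus_inf _ _ Tj) (x := x).
(* Of the nine pairs, merging excludes the constant one and [cut] the four with both domains moving;
   two blocks carry no condition. *)
case Tj : (type_of_dom S j) => [|I Phi|I Phi];
  case Tj1 : (type_of_dom S (j + 1)) => [|I' Phi'|I' Phi'] //=.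
- by apply: merged; rewrite Tj Tj1.
- exact: plus_inf Tj1.
- exact: cut (plus_max _ _ Tj) (plus_min _ _ Tj1).
- exact: cut (plus_max _ _ Tj) (minus_min _ _ Tj1).
- exact: minus_inf Tj.
- exact: cut (minus_max _ _ Tj) (plus_min _ _ Tj1).
- exact: cut (minus_max _ _ Tj) (minus_min _ _ Tj1).
Qed.
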